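(* Let $X, Y$ be Banach spaces with $X$ reflexive, $\Omega\subseteq X$ an open set, $F:\Omega\to Y$ a continuously differentiable function and $C\subset Y$ a nonempty closed convex cone. Take $\tilde{x}\in\Omega$, $R>0$, $L>0$ and $b>0$. Suppose that $F$ satisfies Robinson's condition at $\tilde{x}$ (i.e. $\mathrm{rge}\,T_{\tilde{x}}=Y$), that $$B(\tilde{x},R)\subseteq\Omega,\qquad \|T_{\tilde{x}}^{-1}[F'(y)-F'(x)]\|\le L\|y-x\|\quad\forall x,y\in B(\tilde{x},R),$$ and that $2bL<1$. Moreover, assume that $\|T_{\tilde{x}}^{-1}(-F(\tilde{x}))\|\le b$. Let $0\le\rho<(1-2Lb)/(4L)$ and let $g:[0,+\infty)\to\mathbb{R}$ be the quadratic polynomial $$g(t):=\frac{-1}{L\rho-1}\left[\frac L2(t+\rho)^2-(t+\rho)+b+2\rho\right].$$ Then $g$ has smallest zero $$t_{*,\rho}:=\left(1-\rho L-\sqrt{1-2L(b+2\rho)}\right)/L,$$ and the sequences generated by Newton's method for solving the inclusion $F(x)\in C$ and the equation $g(t)=0$, with starting points $x_0=\hat{x}$, for any $\hat{x}\in B(\tilde{x},\rho)$, and $t_0=0$ respectively, $$x_{k+1}\in x_k+\mathrm{argmin}\{\|d\| : F(x_k)+F'(x_k)d\in C\},\qquad t_{k+1}=t_k-\frac{g(t_k)}{g'(t_k)},\qquad k=0,1,\ldots,$$ are well defined; $\{x_k\}$ is contained in $B(\tilde{x},t_{*,\rho})$; $\{t_k\}$ is strictly increasing, is contained in $[0,t_{*,\rho})$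 and converges to $t_{*,\rho}$; and $$\|x_{k+1}-x_k\|\le t_{k+1}-t_k,\qquad k=0,1,\ldots,$$ $$\|x_{k+1}-x_k\|\le\frac{t_{k+1}-t_k}{(t_k-t_{k-1})^2}\|x_k-x_{k-1}\|^2\le\frac{L}{2\sqrt{1-2L(b+2\rho)}}\|x_k-x_{k-1}\|^2,\qquad k=1,2,\ldots.$$ Moreover, $\{x_k\}$ converges to some $x_*\in B[\tilde{x},t_{*,\rho}]$ such that $F(x_* )\in C$, $$\|x_*-x_k\|\le t_{*,\rho}-t_k,\qquad t_{*,\rho}-t_{k+1}\le\tfrac12(t_{*,\rho}-t_k),\qquad k=0,1,\ldots,$$ and the convergence of $\{x_k\}$ and $\{t_k\}$ to $x_*$ and $t_{*,\rho}$, respectively, is $Q$-quadratic as follows: $$\limsup_{k\to\infty}\frac{\|x_*-x_{k+1}\|}{\|x_*-x_k\|^2}\le\frac{L}{2\sqrt{1-2L(b+2\rho)}},\qquad t_{*,\rho}-t_{k+1}\le\frac{L}{2\sqrt{1-2L(b+2\rho)}}(t_{*,\rho}-t_k)^2,\quad k=0,1,\ldots.$$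
   Context: $B(x,\delta)$ and $B[x,\delta]$ are the open and closed balls with centre $x$ and radius $\delta$. For $z\in\Omega$, $T_z:X\rightrightarrows Y$ is the set-valued map $T_zd=F'(z)d-C$, and $T_z^{-1}:Y\rightrightarrows X$ is its inverse, $T_z^{-1}y=\{d\in X: F'(z)d-y\in C\}$. $\mathrm{rge}\,T_z=\bigcup_{d\in X}T_zd$. For a set-valued map $S$ between Banach spaces, $\mathrm{dom}\,S=\{d: Sd\ne\varnothing\}$, $\|Sd\|:=\inf\{\|v\|: v\in Sd\}$ (with $\|Sd\|=+\infty$ if $Sd=\varnothing$), and $\|S\|:=\sup\{\|Sd\|: d\in\mathrm{dom}\,S,\ \|d\|\le1\}$. For a linear map $A:X\to Y$, $T_z^{-1}A$ is the composition $d\mapsto T_z^{-1}(Ad)$. The sequence $\{x_k\}$ is any sequence obtained by choosing at each step an element of the (possibly multi-element) argmin set.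
   Formalization: The formal theorem adds the hypothesis t_{*,ρ}+ρ ≤ R (for small R the iterates can leave Ω), and the balls containing {x_k} and x_* are centred at the starting point x̂ instead of x̃ (with centre x̃ the claim fails). *)

(* Defs.v *)
From HB Require Import structures.
From mathcomp Require Export all_boot all_order all_algebra.
From mathcomp Require Export all_classical all_reals all_analysis.
Export Order.TTheory GRing.Theory Num.Theory.
Export numFieldNormedType.Exports.

Set Implicit Arguments.
Unset Strict Implicit.
Unset Printing Implicit Defensive.

Local Open Scope classical_set_scope.
Local Open Scope ring_scope.

Section Reflexivity.
Context {K : realType}.
Implicit Type X : normedModType K.

Definition topological_dual X : set (X -> K) :=
  [set phi : X -> K | (scalar phi : Prop) /\ continuous phi].

Definition dual_norm X (phi : X -> K) : K :=
  sup [set `|phi x| | x in [set x | `|x| <= 1]].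

(* An element of the bidual is given by a map on all functions X -> K, of
   which only the values on the topological dual matter. *)
Definition bidual X : set ((X -> K) -> K) :=
  [set Psi |
    (forall a phi psi, topological_dual phi -> topological_dual psi ->
      Psi (fun x => a * phi x + psi x) = a * Psi phi + Psi psi) /\
    exists M : K, forall phi, topological_dual phi ->
      `|Psi phi| <= M * dual_norm phi].

Definition reflexive_space X : Prop :=
  forall Psi, @bidual X Psi ->
    exists x : X, forall phi, topological_dual phi -> Psi phi = phi x.

End Reflexivity.

Section SetValuedMaps.
Context {K : realType} {X Y : normedModType K}.
Implicit Types (S : X -> set Y) (V : set Y).

Definition sv_dom S : set X := [set d | S d !=set0].

Definition sv_range S : set Y := \bigcup_d S d.

Definition sv_inv S : Y -> set X := fun y => [set d | S d y].

(* The infimum is +oo when V is empty. *)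
Definition set_norm V : \bar K := ereal_inf [set `|v|%:E | v in V].

Definition sv_norm S : \bar K :=
  ereal_sup [set set_norm (S d) | d in sv_dom S `&` [set d | `|d| <= 1]].

End SetValuedMaps.

Definition is_cone {K : realType} {Y : lmodType K} (C : set Y) : Prop :=
  forall (t : K) (c : Y), 0 < t -> C c -> C (t *: c).

Section Newton.
Context {K : realType} {X Y : normedModType K}.

(* F stands for a map Omega -> Y: since Omega is open, 'd F x at x in Omega
   does not depend on the values of F outside Omega. The second clause is
   continuity of F' for the operator norm. *)
Definition continuously_differentiable_on (Omega : set X) (F : X -> Y) : Prop :=
  (forall x, Omega x -> differentiable F x) /\
  (forall x, Omega x -> forall e : K, 0 < e ->
     \forall y \near x, forall d : X, `|'d F y d - 'd F x d| <= e * `|d|).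

Variables (F : X -> Y) (C : set Y).

Definition Tmap (z d : X) : set Y := [set 'd F z d - c | c in C].

Definition Tmap_inv (z : X) : Y -> set X := sv_inv (Tmap z).

Definition robinson_condition (z : X) : Prop := sv_range (Tmap z) = setT.

Definition linearized_feasible (x : X) : set X :=
  [set d | C (F x + 'd F x d)].

Definition newton_directions (x : X) : set X :=
  [set d | linearized_feasible x d /\
           forall d', linearized_feasible x d' -> `|d| <= `|d'|].

Definition newton_step (x x' : X) : Prop :=
  exists2 d, newton_directions x d & x' = x + d.

(* However the choices made in the first n steps, the current point is in the
   domain of F and a further step exists. *)
Definition newton_well_defined (Omega : set X) (x0 : X) : Prop :=
  forall (n : nat) (x : nat -> X), x 0%N = x0 ->
    (forall k, (k < n)%N -> newton_step (x k) (x k.+1)) ->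
    Omega (x n) /\ newton_directions (x n) !=set0.

End Newton.

Section Majorant.
Context {K : realType}.
Implicit Types L b rho t : K.

Fixpoint newton_real (g : K -> K) (t0 : K) (k : nat) : K :=
  if k is k'.+1 then
    newton_real g t0 k' - g (newton_real g t0 k') / derive1 g (newton_real g t0 k')
  else t0.

Definition majorant L b rho t : K :=
  - 1 / (L * rho - 1) *
    (L / 2 * (t + rho) ^+ 2 - (t + rho) + b + 2 * rho).

Definition majorant_root L b rho : K :=
  (1 - rho * L - Num.sqrt (1 - 2 * L * (b + 2 * rho))) / L.

Definition quadratic_rate L b rho : K :=
  L / (2 * Num.sqrt (1 - 2 * L * (b + 2 * rho))).

End Majorant.

(* Main.v *)
Require Import Defs.
From HB Require Import structures.
From mathcomp Require Import ring lra.

(* Everything is tested against the functionals phi that are nonnegative on the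
   cone C. In a reflexive space X, if A : X -> Y is linear and continuous, then
   [y + A w \in C] has a solution of norm at most r as soon as
   [- r * dual_norm (phi \o A) <= phi y] for all these phi: the set
   [C - A (ball 0 r)] is closed by weak compactness, and Hahn-Banach separates.
   With N phi := dual_norm (phi \o F'(xt)), the Lipschitz hypothesis reads
   [phi ((F'(y) - F'(x)) d) <= N phi * L * |y - x| * |d|]. It gives a Taylor
   bound for phi \o F by a scalar mean value argument, and
   [N phi <= dual_norm (phi \o F'(x)) / (1 - L * |x - xt|)], hence
   [|x_(k+2) - x_(k+1)| <= (L / 2) |x_(k+1) - x_k|^2 / (1 - L |x_(k+1) - xt|)].
   The Newton iterates of the majorant satisfy this recursion with equality
   and [t_k + rho] in place of [|x_k - xt|], so they dominate by induction. *)

Set Implicit Arguments.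
Unset Strict Implicit.
Unset Printing Implicit Defensive.

Local Open Scope classical_set_scope.
Local Open Scope ring_scope.

(** * Hahn-Banach *)

Section HahnBanach.
Context {K : realType} {V : lmodType K}.
Implicit Types (p q f : V -> K) (E : set V).

Definition segment_closed E := forall a b s t, E a -> E b ->
  0 <= s -> 0 <= t -> s + t = 1 -> E (s *: a + t *: b).

(** Only an inequality is asked, and only for positive scalars, since infima satisfy it readily;
    equality follows by scaling back with the inverse. *)
Definition sublinear q := (forall x y, q (x + y) <= q x + q y) /\
  (forall t x, 0 < t -> q (t *: x) <= t * q x).

Lemma sublinear0 q : sublinear q -> q 0 = 0.
Proof.
move=> [_ qZ]; have := qZ 2 0 ltac:(lra); have := qZ (2^-1) 0 ltac:(lra).
by rewrite !scaler0; lra.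
Qed.

Lemma sublinearZ q t x : sublinear q -> 0 <= t -> q (t *: x) = t * q x.
Proof.
move=> qs; rewrite le_eqVlt => /predU1P[<-|t0].
  by rewrite scale0r mul0r sublinear0.
apply/eqP; rewrite eq_le qs.2//= -ler_pdivlMl//.
have := qs.2 t^-1 (t *: x); rewrite scalerA mulVf ?gt_eqF// scale1r.
by apply; rewrite invr_gt0.
Qed.

Lemma sublinear_oppr_ge q x : sublinear q -> - q (- x) <= q x.
Proof. by move=> qs; have := qs.1 x (- x); rewrite subrr sublinear0//; lra. Qed.

(* The infimal convolution of [q] with the positively homogeneous extension of
   the constant [- beta] on [- E]. *)
Lemma sublinear_below q E (beta : K) : sublinear q -> E !=set0 ->
    segment_closed E -> (forall e, E e -> beta <= q e) ->
  exists q', [/\ sublinear q', forall x, q' x <= q x &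
    forall e, E e -> q' (- e) <= - beta].
Proof.
move=> qs [e0 Ee0] cE Eq.
pose S x := [set z : K | exists t e,
  [/\ 0 <= t, E e & z = q (x + t *: e) - t * beta]].
have S0 x : S x !=set0 by exists (q (x + 0 *: e0) - 0 * beta), 0, e0.
have Slb x : has_lbound (S x).
  exists (- q (- x)) => _ [t [e [t0 Ee ->]]].
  have := qs.1 (x + t *: e) (- x); rewrite addrAC subrr add0r sublinearZ//.
  by have := ler_wpM2l t0 (Eq e Ee); lra.
have inS x z : S x z -> inf (S x) <= z by move=> Sz; apply: ge_inf.
exists (fun x => inf (S x)); split.
- split=> [x y|s x s0].
    rewrite -lerBlDl; apply: lb_le_inf => // z2 [t2 [e2 [t20 Ee2 ->]]].
    rewrite lerBlDl -lerBlDr; apply: lb_le_inf => // z1 [t1 [e1 [t10 Ee1 ->]]].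
    rewrite lerBlDr; have [t12|t12] := eqVneq (t1 + t2) 0.
      have [-> ->] : t1 = 0 /\ t2 = 0 by split; lra.
      rewrite !scale0r !mul0r !subr0 !addr0.
      apply: le_trans (qs.1 x y); apply: inS; exists 0, e0; split => //.
      by rewrite scale0r addr0; lra.
    have t12p : 0 < t1 + t2 by lra.
    (* The convex combination with [(t1 + t2) *: e = t1 *: e1 + t2 *: e2]. *)
    pose e := (t1 / (t1 + t2)) *: e1 + (t2 / (t1 + t2)) *: e2.
    have Ee : E e.
      apply: cE => //; try (apply: divr_ge0 => //; lra).
      by rewrite -mulrDl divff.
    apply: (@le_trans _ _ (q (x + y + (t1 + t2) *: e) - (t1 + t2) * beta)).
      by apply: inS; exists (t1 + t2), e; split => //; lra.
    have -> : x + y + (t1 + t2) *: e = (x + t1 *: e1) + (y + t2 *: e2).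
      rewrite /e scalerDr !scalerA -!(mulrCA _ (t1 + t2)) !divff// !mulr1.
      by rewrite addrACA.
    by have := qs.1 (x + t1 *: e1) (y + t2 *: e2); lra.
  rewrite -ler_pdivrMl//; apply: lb_le_inf => // z [t [e [t0 Ee ->]]].
  rewrite ler_pdivrMl//.
  apply: (@le_trans _ _ (q (s *: (x + t *: e)) - (s * t) * beta)).
    apply: inS; exists (s * t), e; split => //; first by rewrite mulr_ge0// ltW.
    by rewrite scalerDr scalerA.
  by rewrite sublinearZ//; [lra|exact: ltW].
- move=> x; apply: inS; exists 0, e0; split => //.
  by rewrite scale0r addr0; lra.
- move=> e Ee; apply: inS; exists 1, e; split => //.
  by rewrite scale1r addNr sublinear0//; lra.
Qed.

(** Zorn's lemma for the reversed pointwise order below [p]. A chain is bounded by its pointwise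
    infimum, finite because [q x >= - q (- x) >= - p (- x)]. *)
Lemma sublinear_minimal p : sublinear p -> exists f, [/\ sublinear f,
  forall x, f x <= p x &
  forall q, sublinear q -> (forall x, q x <= f x) -> q = f].
Proof.
move=> ps; pose P q := sublinear q /\ forall x, q x <= p x; pose T := {q | P q}.
pose le (q1 q2 : T) := `[< forall x, sval q2 x <= sval q1 x >].
have [||||f fmin] := @Zorn T le.
- by move=> q; apply/asboolP.
- move=> q1 q2 q3 /asboolP q12 /asboolP q23; apply/asboolP => x.
  exact: le_trans (q23 x) (q12 x).
- move=> [q1 q1P] [q2 q2P] /asboolP q12 /asboolP q21.
  apply: eq_exist; apply/funext => x.
  by apply/eqP; rewrite eq_le q12 q21.
- move=> A totA; have [[q0 Aq0]|A0] := pselect (A !=set0); last first.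
    exists (exist P p (conj ps (fun x => lexx (p x)))) => q Aq.
    by exfalso; apply: A0; exists q.
  pose S x := [set sval q x | q in A].
  have Slb x : has_lbound (S x).
    exists (- p (- x)) => _ [[q [qs qp]] _ <-] /=.
    by apply: le_trans (sublinear_oppr_ge x qs); rewrite lerN2.
  have S0 x : S x !=set0 by exists (sval q0 x), q0.
  have inS x (q : T) : A q -> inf (S x) <= sval q x.
    by move=> Aq; apply: ge_inf => //; exists q.
  have Is : sublinear (fun x => inf (S x)).
    split=> [x y|t x t0].
      rewrite -lerBlDl; apply: lb_le_inf => // _ [q2 Aq2 <-].
      rewrite lerBlDl -lerBlDr; apply: lb_le_inf => // _ [q1 Aq1 <-].
      rewrite lerBlDr; have [/asboolP q12|/asboolP q21] := totA _ _ Aq1 Aq2.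
        apply: le_trans (inS _ _ Aq2) _.
        apply: le_trans ((svalP q2).1.1 x y) _.
        by rewrite lerD2r.
      apply: le_trans (inS _ _ Aq1) _.
      apply: le_trans ((svalP q1).1.1 x y) _.
      by rewrite lerD2l.
    rewrite -ler_pdivrMl//; apply: lb_le_inf => // _ [q Aq <-].
    rewrite ler_pdivrMl//; apply: le_trans (inS _ _ Aq) _.
    exact: (svalP q).1.2.
  have Ip x : inf (S x) <= p x.
    exact: le_trans (inS x _ Aq0) ((svalP q0).2 x).
  exists (exist P _ (conj Is Ip)) => q Aq; apply/asboolP => x /=.
  exact: inS.
exists (sval f); split; [exact: (svalP f).1|exact: (svalP f).2|].
move=> q qs qf.
have qp x : q x <= p x by exact: le_trans (qf x) ((svalP f).2 x).
by rewrite -(fmin (exist P q (conj qs qp))) //; apply/asboolP.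
Qed.

(* A minimal sublinear functional is odd, by minimality against the functional
   of [sublinear_below] for a singleton [E]; hence it is linear. *)
Lemma sublinear_dominates_scalar p : sublinear p ->
  exists f, (scalar f : Prop) /\ forall x, f x <= p x.
Proof.
move=> /sublinear_minimal[f [fs fp fmin]]; exists f; split => //.
have fN y : f (- y) = - f y.
  have [|||q [qs qf qy]] := @sublinear_below f [set y] (f y) fs.
  - by exists y.
  - by move=> _ _ s t -> -> _ _ st; rewrite /= -scalerDl st scale1r.
  - by move=> _ ->.
  have := qy y erefl; rewrite (fmin q)// => fyN.
  by have := sublinear_oppr_ge y fs; lra.
have fD x y : f (x + y) = f x + f y.
  apply/eqP; rewrite eq_le fs.1/=.
  by have := fs.1 (- x) (- y); rewrite -opprD !fN; lra.
have fZ (a : K) x : f (a *: x) = a * f x.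
  have [a0|a0] := leP 0 a; first exact: sublinearZ.
  rewrite -[a]opprK scaleNr fN sublinearZ//; last by rewrite oppr_ge0 ltW.
  by rewrite !mulNr.
by move=> a x y; rewrite fD fZ.
Qed.

End HahnBanach.

(** * Topological dual and weak limits *)

Section TopologicalDual.
Context {K : realType} {V : normedModType K}.
Implicit Types (phi : V -> K).

Lemma convex_set_segment_closed (E : set V) :
  convex_set E -> segment_closed E.
Proof.
move=> cE a b s t Ea Eb s0 t0 st; have s1 : s <= 1 by lra.
have := cE a b (Itv01 s0 s1); rewrite !inE => /(_ Ea Eb).
by rewrite (_ : t = 1 - s); last lra.
Qed.

Lemma dualD phi x y : topological_dual phi -> phi (x + y) = phi x + phi y.
Proof. by move=> [lin _]; have := lin 1 x y; rewrite scale1r mul1r. Qed.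

Lemma dual0 phi : topological_dual phi -> phi 0 = 0.
Proof. by move=> d; have := dualD 0 0 d; rewrite addr0; lra. Qed.

Lemma dualZ phi a x : topological_dual phi -> phi (a *: x) = a * phi x.
Proof.
by move=> d; have [lin _] := d; have := lin a x 0; rewrite !addr0 dual0// addr0.
Qed.

Lemma dualN phi x : topological_dual phi -> phi (- x) = - phi x.
Proof. by move=> d; rewrite -scaleN1r dualZ// mulN1r. Qed.

Lemma dualB phi x y : topological_dual phi -> phi (x - y) = phi x - phi y.
Proof. by move=> d; rewrite dualD// dualN. Qed.

Lemma dual_bounded phi : topological_dual phi ->
  exists2 M, 0 <= M & forall x, `|phi x| <= M * `|x|.
Proof.
move=> [lin cphi].
pose phiM := GRing.isLinear.Build K V K^o *%R phi lin.
pose phiL : {linear V -> K^o} := HB.pack phi phiM.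
have /linear_bounded_continuous/linear_boundedP : continuous phiL by [].
by move=> /pinfty_ex_gt0[M /ltW M0 phiM']; exists M.
Qed.

Lemma bounded_scalar_dual phi M : (scalar phi : Prop) ->
  (forall x, `|phi x| <= M * `|x|) -> topological_dual phi.
Proof.
move=> lin phi_le; split => //.
pose phiM := GRing.isLinear.Build K V K^o *%R phi lin.
pose phiL : {linear V -> K^o} := HB.pack phi phiM.
suff : continuous phiL by [].
apply/linear_bounded_continuous/linear_boundedP.
near=> r => x; apply: le_trans (phi_le x) _.
by apply: ler_wpM2r => //; near: r; exact: nbhs_pinfty_ge.
Unshelve. all: by end_near. Qed.

Lemma dual_normP phi x : topological_dual phi -> phi x <= dual_norm phi * `|x|.
Proof.
move=> d; have [M M0 phiM] := dual_bounded d.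
have ub v : `|v| <= 1 -> `|phi v| <= dual_norm phi.
  move=> v1; apply: ub_le_sup; last by exists v.
  exists M => _ [u u1 <-]; apply: le_trans (phiM u) _.
  by rewrite ler_piMr.
have [->|x0] := eqVneq x 0; first by rewrite dual0// normr0 mulr0.
have nx : 0 < `|x| by rewrite normr_gt0.
have := ub (`|x|^-1 *: x); rewrite normrZ normfV normr_id mulVf ?gt_eqF//.
move=> /(_ (lexx _)); rewrite dualZ// normrM normfV normr_id ler_pdivrMl//.
by rewrite mulrC; apply: le_trans; exact: ler_norm.
Qed.

Lemma dual_norm_ge0 phi : topological_dual phi -> 0 <= dual_norm phi.
Proof.
move=> d; have [M M0 phiM] := dual_bounded d.
have -> : 0 = `|phi 0| by rewrite dual0// normr0.
apply: ub_le_sup; last by exists 0 => //=; rewrite normr0.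
exists M => _ [u u1 <-]; apply: le_trans (phiM u) _.
by rewrite ler_piMr.
Qed.

Lemma dual_norm_le phi m : topological_dual phi ->
  (forall x, `|x| <= 1 -> phi x <= m) -> dual_norm phi <= m.
Proof.
move=> d phim; apply: ge_sup.
  by exists `|phi 0|, 0 => //=; rewrite normr0.
move=> _ [x x1 <-]; rewrite ler_norml phim// andbT lerNl -dualN// phim//.
by rewrite normrN.
Qed.

(** A ball of radius [delta] around [y] misses [D], so the norm is at least [delta] on [E = D - y].
    [sublinear_below] lowers the norm to a sublinear [p] with [p (- e) <= - delta] on [E]; a linear
    functional below [p] is continuous, being below the norm, and has the gap [delta]. *)
Lemma dual_separation (D : set V) y : D !=set0 -> closed D ->
    segment_closed D -> ~ D y ->
  exists2 phi, topological_dual phi &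
    exists2 delta, 0 < delta & forall d, D d -> phi y + delta <= phi d.
Proof.
move=> [d0 Dd0] clD cD nDy.
have : nbhs y (~` D) by apply: open_nbhs_nbhs; split => //; exact: closed_openC.
move=> /nbhs_ballP[delta /= delta0 yD].
pose E := [set e | D (e + y)].
have cE : segment_closed E.
  move=> a b s t Ea Eb s0 t0 st; rewrite /E /=.
  have -> : s *: a + t *: b + y = s *: (a + y) + t *: (b + y).
    by rewrite !scalerDr addrACA -scalerDl st scale1r.
  exact: cD.
have ns : sublinear (fun x : V => `|x|).
  by split=> [x z|t x t0]; [exact: ler_normD|rewrite normrZ gtr0_norm].
have [||p [ps pn pE]] := @sublinear_below _ _ _ E delta ns _ cE.
- by exists (d0 - y); rewrite /E /= subrK.
- move=> e Ee; rewrite leNgt; apply/negP => edelta; apply: (yD (e + y)) Ee.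
  by rewrite -ball_normE /= opprD addrCA subrr addr0 normrN.
have [phi [lin phip]] := sublinear_dominates_scalar ps.
have phin x : phi x <= `|x| by exact: le_trans (phip x) (pn x).
have phiN x : phi (- x) = - phi x.
  by have := lin (-1) x (-x); have := lin (- 1) x 0; have := lin 1 0 0;
     rewrite !scaleN1r !scaler0 !addr0 !mul1r mulN1r; lra.
have phiT : topological_dual phi.
  apply: (@bounded_scalar_dual _ 1) => // x.
  by rewrite mul1r ler_norml phin andbT lerNl -phiN -[leRHS]normrN.
exists phi => //; exists delta => // d Dd.
have /pE : E (d - y) by rewrite /E /= subrK.
by move=> /(le_trans (phip _)); rewrite phiN dualB//; lra.
Qed.

End TopologicalDual.

Lemma dual_comp (K : realType) (X Y : normedModType K) (A : {linear X -> Y})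
    (phi : Y -> K) :
  continuous A -> topological_dual phi -> topological_dual (phi \o A).
Proof.
move=> cA [lin cphi]; split => [a x y|x].
  by rewrite /= linearP lin.
exact: continuous_comp (cA x) (cphi _).
Qed.

Section WeakCompactness.
Context {K : realType}.

(** Compactness gives a cluster point; an ultrafilter contains each neighbourhood of it or the
    complement, and clustering excludes the latter. *)
Lemma ultra_bounded_cvg (T : Type) (U : set_system T) (h : T -> K) (M : K) :
  UltraFilter U -> (\forall t \near U, `|h t| <= M) -> cvg (h @ U).
Proof.
move=> UU hM; have := @segment_compact K (- M) M.
move=> /(_ (h @ U) _)[|p [_ clp]].
  by near=> t; rewrite /= in_itv /= -ler_norml; near: t.
apply/cvg_ex; exists p => B Bp.
have [//|hB] := in_ultra_setVsetC (h @^-1` B) UU.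
by have [z []] := clp (~` B) B hB Bp.
Unshelve. all: by end_near. Qed.

(** The limits of [phi (f t)] along [U] define a functional of [phi] bounded by [M * dual_norm phi],
    hence an element of the bidual, which reflexivity represents by a point. *)
Lemma reflexive_weak_limit (X : normedModType K) (T : Type) (U : set_system T)
    (f : T -> X) (M : K) : reflexive_space X -> UltraFilter U ->
    (\forall t \near U, `|f t| <= M) ->
  exists x, forall phi, topological_dual phi -> phi (f t) @[t --> U] --> phi x.
Proof.
move=> rX UU fM.
have [t0 ft0] := filter_ex fM; have M0 : 0 <= M by exact: le_trans ft0.
have bd phi : topological_dual phi ->
    \forall t \near U, `|phi (f t)| <= M * dual_norm phi.
  move=> d; near=> t.
  have ftM : dual_norm phi * `|f t| <= M * dual_norm phi.
    by rewrite mulrC ler_wpM2r ?dual_norm_ge0//; near: t.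
  rewrite ler_norml (le_trans (dual_normP _ d))// andbT lerNl -dualN//.
  by rewrite (le_trans (dual_normP _ d))// normrN.
have cv phi : topological_dual phi -> cvg (phi (f t) @[t --> U]).
  by move=> /bd; exact: ultra_bounded_cvg.
have [|x xP] := rX (fun phi => lim (phi (f t) @[t --> U])).
  split=> [a phi psi dphi dpsi|].
    apply: cvg_lim => //; apply: cvgD; last exact: cv.
    by apply: cvgMr; exact: cv.
  exists M => phi d; rewrite ler_norml; apply/andP; split.
    by apply: limr_ge; [exact: cv|near=> t; move: (near (bd _ d) t);
      rewrite ler_norml => /(_ _)/andP[]//; near: t].
  by apply: limr_le; [exact: cv|near=> t; move: (near (bd _ d) t);
      rewrite ler_norml => /(_ _)/andP[]//; near: t].
exists x => phi d; rewrite -xP//; exact: cv.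
Unshelve. all: by end_near. Qed.

(* Convex sets are weakly closed; the points are tested through [A], so that
   [f] needs only to converge weakly. *)
Lemma weak_limit_closed (X Y : normedModType K) (T : Type) (U : set_system T)
    (A : {linear X -> Y}) (D : set Y) (f : T -> X) (g : T -> Y) x y :
    ProperFilter U -> continuous A -> closed D -> segment_closed D ->
    (forall phi, topological_dual phi -> phi (f t) @[t --> U] --> phi x) ->
    g @ U --> y -> (\forall t \near U, D (g t + A (f t))) ->
  D (y + A x).
Proof.
move=> UU cA clD cD fx gy DU; apply: contrapT => nD.
have [t0 Dt0] := filter_ex DU.
have [|phi d [delta delta0 phiD]] := dual_separation _ clD cD nD.
  by exists (g t0 + A (f t0)).
have lim_phi :
    (phi (g t) + (phi \o A) (f t)) @[t --> U] --> phi y + (phi \o A) x.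
  apply: cvgD; last by apply: fx; exact: dual_comp.
  exact: (cvg_comp _ _ gy (d.2 y)).
suff : phi (y + A x) + delta <= phi y + (phi \o A) x.
  by rewrite dualD//=; lra.
apply: (cvgr_to_ge lim_phi); near=> t.
by rewrite /= -dualD//; apply: phiD; near: t.
Unshelve. all: by end_near. Qed.

Lemma weak_limit_norm_le (X : normedModType K) (T : Type) (U : set_system T)
    (f : T -> X) x r : ProperFilter U ->
    (forall phi, topological_dual phi -> phi (f t) @[t --> U] --> phi x) ->
    (\forall t \near U, `|f t| <= r) ->
  `|x| <= r.
Proof.
move=> UU fx fr.
have clB : closed [set v : X | `|v| <= r].
  have -> : [set v : X | `|v| <= r] = Num.norm @^-1` [set s | s <= r] by [].
  apply: preimage_closed; last exact: closed_le.
  by move=> v _; exact: norm_continuous.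
have cB : segment_closed [set v : X | `|v| <= r].
  move=> a b s t /= ar br s0 t0 st; apply: le_trans (ler_normD _ _) _.
  rewrite !normrZ !ger0_norm//; have := ler_wpM2l s0 ar.
  by have := ler_wpM2l t0 br; nra.
have := @weak_limit_closed X X T U idfun _ f (cst 0) x 0 UU _ clB cB fx.
rewrite /= add0r; apply.
- by move=> v; exact: cvg_id.
- exact: cvg_cst.
- by near=> t; rewrite add0r /=; near: t.
Unshelve. all: by end_near. Qed.

End WeakCompactness.

(** * Linear systems over a convex cone *)

Section ConvexCones.
Context {K : realType} {Y : normedModType K}.
Implicit Types (C : set Y).

(** [is_cone] allows positive factors only, so 0 is reached as a limit of multiples of [c]. *)
Lemma closed_cone0 C : C !=set0 -> closed C -> is_cone C -> C 0.
Proof.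
move=> [c Cc] clC coneC.
have : (fun n => (n.+1%:R^-1 : K) *: c) @ \oo --> (0 : K) *: c.
  by apply: cvgZr_tmp; exact: cvg_harmonic.
rewrite scale0r; apply: closed_cvg => //.
by near=> n; apply: coneC.
Unshelve. all: by end_near. Qed.

Definition dual_cone C : set (Y -> K) :=
  [set phi | topological_dual phi /\ forall c, C c -> 0 <= phi c].

End ConvexCones.

Section Duality.
Context {K : realType} {X Y : normedModType K}.
Variables (A : {linear X -> Y}) (C : set Y).
Hypotheses (X_reflexive : reflexive_space X) (A_cont : continuous A)
  (C_closed : closed C) (C_segment : segment_closed C).

(** Direct method: a minimizing sequence has a weak limit along an ultrafilter finer than [\oo]; the
    feasible set and closed balls are weakly closed. *)
Lemma linear_system_min_norm y : [set d | C (y + A d)] !=set0 ->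
  exists2 d, C (y + A d) & forall d', C (y + A d') -> `|d| <= `|d'|.
Proof.
move=> [d0 Cd0]; pose N := [set `|d| | d in [set d | C (y + A d)]].
have N0 : N !=set0 by exists `|d0|, d0.
have Nlb : has_lbound N by exists 0 => _ [d _ <-].
have /choice[f fP] (n : nat) :
    exists d, C (y + A d) /\ `|d| < inf N + n.+1%:R^-1.
  have : 0 < n.+1%:R^-1 :> K by [].
  by by move=> /inf_adherent/(_ (conj N0 Nlb))[_ [d Cd <-] dN]; exists d.
have [U [UU ooU]] := ultraFilterLemma eventually_filter.
have f_le (e : K) : 0 < e -> \forall n \near U, `|f n| <= inf N + e.
  move=> e0; apply: ooU; near=> n; apply: ltW.
  apply: lt_le_trans (fP n).2 _; rewrite lerD2l ltW//.
  by near: n; exact: (near_infty_natSinv_lt (PosNum e0)).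
have [x fx] := reflexive_weak_limit X_reflexive UU (f_le 1 ltr01).
exists x.
  apply: (@weak_limit_closed _ _ _ _ U A C f (cst y) x y _ A_cont) => //.
    exact: cvg_cst.
  by apply: filterE => n /=; have [] := fP n.
move=> d' Cd'; apply: (@le_trans _ _ (inf N)); last first.
  by apply: ge_inf => //; exists d'.
apply/ler_addgt0Pr => e e0.
exact: (weak_limit_norm_le _ fx (f_le e e0)).
Unshelve. all: by end_near. Qed.

(** A point [e] of the closure is approached along an ultrafilter; the corresponding [w] have a weak
    limit [x] in the ball, and [e + A x] lies in [C]. *)
Lemma closed_sub_image_ball r :
  closed [set e | exists c w, [/\ C c, `|w| <= r & e = c - A w]].
Proof.
set E := [set e | _] => e clEe.
have /choice[f fP] (z : Y) : exists w, E z -> C (z + A w) /\ `|w| <= r.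
  have [[c [w [Cc wr ->]]]|nE] := pselect (E z); last by exists 0.
  by exists w => _; rewrite subrK.
have PF := within_nbhs_proper clEe.
have [U [UU wU]] := ultraFilterLemma PF.
have UE : \forall z \near U, E z by exact: (wU _ (withinT _ _)).
have fr : \forall z \near U, `|f z| <= r.
  by apply: filterS UE => z /fP[].
have [x fx] := reflexive_weak_limit X_reflexive UU fr.
exists (e + A x), x; split; last by rewrite addrK.
  apply: (@weak_limit_closed _ _ _ _ U A C f id _ e _ A_cont) => //.
    by apply: cvg_trans wU _; exact: cvg_within.
  by apply: filterS UE => z /fP[].
exact: (weak_limit_norm_le _ fx fr).
Qed.

(** If [y] is not in [E], test the separating functional on points [c - A w]: [w = 0] shows that it
    is nonnegative on [C], and [c = 0] gives [dual_norm (phi \o A) * r <= - (phi y + delta)],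
    against the hypothesis. *)
Lemma linear_system_solvable y r : C !=set0 -> is_cone C -> 0 <= r ->
    (forall phi, dual_cone C phi -> - (dual_norm (phi \o A) * r) <= phi y) ->
  exists2 w, `|w| <= r & C (y + A w).
Proof.
move=> C0 coneC r0 Hphi.
have C00 : C 0 by exact: closed_cone0.
pose E := [set e | exists c w, [/\ C c, `|w| <= r & e = c - A w]].
suff [c [w [Cc wr yE]]] : E y by exists w => //; rewrite yE subrK.
apply: contrapT => nEy.
have [||phi d [delta delta0 phiE]] :=
    @dual_separation _ _ E y _ (@closed_sub_image_ball r) _ nEy.
- by exists 0, 0, 0; split; rewrite ?normr0// linear0 subr0.
- move=> _ _ s t [c [w [Cc wr ->]]] [c' [w' [Cc' wr' ->]]] s0 t0 st.
  exists (s *: c + t *: c'), (s *: w + t *: w'); split.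
  + exact: C_segment.
  + apply: le_trans (ler_normD _ _) _; rewrite !normrZ !ger0_norm//.
    have := ler_wpM2l s0 wr; have := ler_wpM2l t0 wr'; nra.
  + rewrite [A (_ + _)]linearD [A (s *: _)]linearZ [A (t *: _)]linearZ.
    by rewrite /= !scalerBr opprD addrACA.
have phiC c : C c -> phi y + delta <= phi c.
  move=> Cc; apply: phiE; exists c, 0.
  by rewrite normr0 linear0 subr0.
have phiC0 : dual_cone C phi.
  split=> // c Cc; rewrite leNgt; apply/negP => pc0.
  (* Scaled by this factor, [c] would violate the lower bound [phi y + delta] valid on all of
     [C]. *)
  pose t := (`|phi y| + 1) / - phi c.
  have t0 : 0 < t.
    by apply: divr_gt0; [have := normr_ge0 (phi y); lra|lra].
  have := phiC _ (coneC _ _ t0 Cc); rewrite dualZ//.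
  have -> : t * phi c = - (`|phi y| + 1) by rewrite /t; field; lra.
  by have := ler_norm (- phi y); rewrite normrN; lra.
have phiA w : `|w| <= r -> phi (A w) <= - (phi y + delta).
  move=> wr; have /phiE : E (0 - A w) by exists 0, w.
  by rewrite dualB// dual0//; lra.
have dA : topological_dual (phi \o A) by exact: dual_comp.
have : dual_norm (phi \o A) * r <= - (phi y + delta).
  have [r00|r00] := eqVneq r 0.
    have := phiA 0; rewrite linear0 (dual0 d) normr0 r00 mulr0.
    by move=> /(_ (lexx _)).
  have rp : 0 < r by rewrite lt_neqAle eq_sym r00.
  rewrite -ler_pdivlMr//; apply: dual_norm_le => // w w1 /=.
  rewrite ler_pdivlMr// mulrC -dualZ// -linearZ; apply: phiA.
  by rewrite normrZ gtr0_norm// ler_piMr.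
by have := Hphi _ phiC0; lra.
Qed.

End Duality.

(** * Newton steps under Robinson's condition *)

Lemma set_norm_lt (K : realType) (X : normedModType K) (V : set X) (l e : K) :
  (set_norm V <= l%:E)%E -> 0 < e -> exists2 v, V v & `|v| < l + e.
Proof.
move=> Vl e0; apply: contrapT => nV.
have : ((l + e)%:E <= set_norm V)%E.
  apply: le_ereal_inf_tmp => _ [v Vv <-]; rewrite lee_fin leNgt.
  by apply/negP => vle; apply: nV; exists v.
by move=> /le_trans/(_ Vl); rewrite lee_fin; lra.
Qed.

Lemma is_derive_dual_line (K : realType) (X Y : normedModType K) (F : X -> Y)
    (phi : Y -> K) (x d : X) (s : K) :
  topological_dual phi -> differentiable F (x + s *: d) ->
  is_derive s 1 (fun s => phi (F (x + s *: d))) (phi ('d F (x + s *: d) d)).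
Proof.
move=> dphi dF; set z := x + s *: d in dF *.
have : h^-1 *: (F (h *: d + z) - F z) @[h --> (0 : K)^'] --> 'd F z d.
  by rewrite -deriveE//; exact: diff_derivable.
move=> /(cvg_comp _ _)/(_ (dphi.2 _)) => lim_phi.
have lim_line : h^-1 *: (phi (F (x + (h *: 1 + s) *: d)) - phi (F z))
    @[h --> (0 : K)^'] --> phi ('d F z d).
  apply: cvg_trans lim_phi; apply: near_eq_cvg; near=> h => /=.
  rewrite dualZ// dualB// [h *: 1]mulr1 scalerDl [h *: d + z]addrCA.
  by rewrite [h *: d + _]addrC [s *: d + _]addrC.
split; first by apply/cvg_ex; exists (phi ('d F z d)).
exact: cvg_lim lim_line.
Unshelve. all: by end_near. Qed.

Section RobinsonNewton.
Context {K : realType} {X Y : normedModType K}.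
Variables (F : X -> Y) (C : set Y) (xt : X) (R L : K).
Hypotheses (X_reflexive : reflexive_space X)
  (F_diff : forall x, ball xt R x -> differentiable F x)
  (C_nonempty : C !=set0) (C_closed : closed C) (C_segment : segment_closed C)
  (C_cone : is_cone C) (R_gt0 : 0 < R) (L_ge0 : 0 <= L)
  (F_robinson : robinson_condition F C xt)
  (F_lipschitz : forall x y, ball xt R x -> ball xt R y ->
    (sv_norm (fun d => Tmap_inv F C xt ('d F y d - 'd F x d)%R)
       <= (L * `|y - x|)%:E)%E).

Local Notation N phi := (dual_norm (phi \o 'd F xt)).

Lemma dual_cone_diff phi x : dual_cone C phi -> ball xt R x ->
  topological_dual (phi \o 'd F x).
Proof.
by move=> [d _] xR; apply: dual_comp => //; exact/diff_continuous/F_diff.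
Qed.

Lemma dual_cone_N_ge0 phi : dual_cone C phi -> 0 <= N phi.
Proof.
by move=> phiC; apply/dual_norm_ge0/dual_cone_diff => //; exact: ballxx.
Qed.

(** The cone part of [w] only lowers [phi w], so norms of preimages turn into scalar bounds. *)
Lemma dual_cone_Tmap phi v w : dual_cone C phi -> Tmap F C xt v w ->
  phi w <= N phi * `|v|.
Proof.
move=> phiC [c Cc <-]; have [d phi0] := phiC.
have := dual_normP v (dual_cone_diff phiC (ballxx xt R_gt0)).
by rewrite dualB//= ; have := phi0 _ Cc; lra.
Qed.

Lemma dual_cone_Tmap_inv phi w l : dual_cone C phi ->
  (set_norm (Tmap_inv F C xt w) <= l%:E)%E -> phi w <= N phi * l.
Proof.
move=> phiC wl; have N0 := dual_cone_N_ge0 phiC.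
apply/ler_addgt0Pr => e e0.
(* The infimum may not be attained; a slack of [e / (N phi + 1)] costs at most [e], even if [N phi]
   is zero. *)
have N1 : 0 < N phi + 1 by lra.
have [v wv vl] := set_norm_lt wl (divr_gt0 e0 N1).
apply: le_trans (dual_cone_Tmap phiC wv) _.
apply: le_trans (ler_wpM2l N0 (ltW vl)) _.
rewrite mulrDr lerD2l mulrCA ler_piMr ?ltW//.
by rewrite ltr_pdivrMr//; lra.
Qed.

Lemma robinsonP w : exists v, Tmap F C xt v w.
Proof.
have : sv_range (Tmap F C xt) w by rewrite F_robinson.
by move=> [v _ ?]; exists v.
Qed.

Lemma dual_cone_lipschitz phi x y d : dual_cone C phi ->
  ball xt R x -> ball xt R y ->
  phi ('d F y d - 'd F x d) <= N phi * (L * `|y - x|) * `|d|.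
Proof.
move=> phiC xR yR; have [dphi _] := phiC.
have small v : `|v| <= 1 -> phi ('d F y v - 'd F x v) <= N phi * (L * `|y - x|).
  move=> v1; apply: dual_cone_Tmap_inv => //.
  apply: le_trans (F_lipschitz xR yR); apply: ereal_sup_ubound.
  (* The supremum in [sv_norm] runs over the domain only; Robinson's condition puts every [v] in
     it. *)
  exists v => //; split => //.
  by have [u] := robinsonP ('d F y v - 'd F x v); exists u.
have [->|d0] := eqVneq d 0.
  by rewrite ['d F y 0]linear0 ['d F x 0]linear0 subrr (dual0 dphi) normr0 mulr0.
have nd : 0 < `|d| by rewrite normr_gt0.
have := small (`|d|^-1 *: d); rewrite normrZ normfV normr_id mulVf ?gt_eqF//.
move=> /(_ (lexx _)); rewrite ['d F y _]linearZ ['d F x _]linearZ/= -scalerBr.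
by rewrite (dualZ _ _ dphi) ler_pdivrMl// mulrC.
Qed.

Lemma ball_segment x d s : ball xt R x -> ball xt R (x + d) ->
  0 <= s -> s <= 1 -> ball xt R (x + s *: d).
Proof.
rewrite -ball_normE /= => xR xdR s0 s1.
have -> : xt - (x + s *: d) = (1 - s) *: (xt - x) + s *: (xt - (x + d)).
  rewrite !opprD !addrA [s *: (_ - d)]scalerBr addrA -scalerDl.
  by rewrite subrK scale1r.
apply: le_lt_trans (ler_normD _ _) _; rewrite !normrZ !ger0_norm//; last by lra.
have [->|sn0] := eqVneq s 0; first by rewrite subr0 mul1r mul0r addr0.
have sp : 0 < s by rewrite lt_neqAle eq_sym sn0.
have /(ler_wpM2l) := ltW xR => /(_ (1 - s) ltac:(lra)).
by have := xdR; rewrite -(ltr_pM2l sp); lra.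
Qed.

(* Taylor's formula with integral remainder is only needed against the
   functionals of the dual cone, where it is a scalar mean value argument. *)
Lemma dual_cone_taylor phi x d : dual_cone C phi ->
  ball xt R x -> ball xt R (x + d) ->
  phi (F x + 'd F x d) - N phi * (L / 2 * `|d| ^+ 2) <= phi (F (x + d)).
Proof.
move=> phiC xR xdR; have [dphi _] := phiC.
have N0 := dual_cone_N_ge0 phiC.
(* [f] is [phi \o F] along the segment, minus its tangent part, plus a quadratic term chosen so that
   the Lipschitz bound makes [df] nonnegative; the claim is [f 0 <= f 1]. *)
pose k := N phi * L * `|d| ^+ 2.
pose df s := phi ('d F (x + s *: d) d) - phi ('d F x d) + k * s.
pose f s := phi (F (x + s *: d)) - phi ('d F x d) * s + k / 2 * s ^+ 2.
have segR (s : K) : s \in `[0, 1] -> ball xt R (x + s *: d).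
  by rewrite in_itv /= => /andP[s0 s1]; exact: ball_segment.
have fdf (s : K) : s \in `[0, 1] -> is_derive s 1 f (df s).
  move=> s01; have := is_derive_dual_line dphi (F_diff (segR _ s01)).
  move=> dline; rewrite /f /df; apply: is_derive_eq; rewrite /GRing.scale/=.
  by field.
have fdf_oo (s : K) : s \in `]0, 1[ -> is_derive s 1 f (df s).
  by move=> s01; apply: fdf; exact: subset_itv_oo_cc.
have cf : {within `[0, 1], continuous f}.
  apply: derivable_within_continuous => s s01.
  exact: (@ex_derive _ _ _ _ _ _ _ (fdf s s01)).
have le01 : (0 : K) <= 1 by exact: ler01.
have [c c01] := MVT_segment le01 fdf_oo cf.
rewrite /f scale1r scale0r addr0 subr0 expr0n /= !mulr0 subr0 !addr0 !mulr1.
rewrite expr1n mulr1 => fE.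
(* The arguments run from [x + c *: d] back to [x], as a lower bound on the derivative is wanted. *)
have := dual_cone_lipschitz d phiC (segR _ c01) xR.
move: c01; rewrite in_itv /= => /andP[c0 c1].
rewrite opprD addrA subrr add0r normrN normrZ ger0_norm// dualB// => lip.
have : 0 <= df c by rewrite /df /k; lra.
by rewrite dualD// -fE /k; lra.
Qed.

(** Dual form of the perturbation lemma for inverses: from [xt] to [x], [N phi] shrinks at most by
    the factor [1 - L * |x - xt|], so the solution bound grows at most by its inverse. *)
Lemma newton_direction_le x r : ball xt R x -> L * `|x - xt| < 1 -> 0 <= r ->
    (forall phi, dual_cone C phi -> - (N phi * r) <= phi (F x)) ->
  exists2 w, `|w| <= r / (1 - L * `|x - xt|) & C (F x + 'd F x w).
Proof.
move=> xR xt1 r0 Hr; have k1 : 0 < 1 - L * `|x - xt| by rewrite subr_gt0.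
apply: linear_system_solvable => //.
- exact/diff_continuous/F_diff.
- by rewrite divr_ge0// ltW.
move=> phi phiC; apply: le_trans (Hr _ phiC); rewrite lerN2.
have [dphi _] := phiC; have xtR := ballxx xt R_gt0.
rewrite mulrA ler_pdivlMr// mulrAC ler_wpM2r// mulrBr mulr1 lerBlDr.
apply: dual_norm_le => [|w w1]; first exact: dual_cone_diff.
have := dual_cone_lipschitz w phiC xR xtR.
have := dual_normP w (dual_cone_diff phiC xR).
rewrite dualB//= distrC.
have := ler_wpM2l (dual_norm_ge0 (dual_cone_diff phiC xR)) w1.
have NL : 0 <= N phi * (L * `|x - xt|).
  by rewrite mulr_ge0 ?dual_cone_N_ge0// mulr_ge0.
by have := ler_wpM2l NL w1; lra.
Qed.

(** Robinson's condition at [xt] gives [v] with [- F x] in [Tmap F C xt v], hence a residual bound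
    by the norm of [v]. Feasibility follows, and then a shortest direction exists. *)
Lemma newton_directions_nonempty x : ball xt R x -> L * `|x - xt| < 1 ->
  newton_directions F C x !=set0.
Proof.
move=> xR xt1; have [v [c Cc vF]] := robinsonP (- F x).
have [phi phiC|w _ Cw] := @newton_direction_le x `|v| xR xt1 (normr_ge0 _).
  have [dphi _] := phiC; rewrite lerNl -dualN//.
  by apply: dual_cone_Tmap => //; exists c.
have [|d Cd dmin] := linear_system_min_norm X_reflexive _ C_closed C_segment
  (ex_intro _ w Cw).
  exact/diff_continuous/F_diff.
by exists d.
Qed.

(** The linearization at [x] lands in [C], so only the Taylor remainder can make [phi (F x')]
    negative. *)
Lemma newton_residual phi x x' : dual_cone C phi -> newton_step F C x x' ->
  ball xt R x -> ball xt R x' ->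
  - (N phi * (L / 2 * `|x' - x| ^+ 2)) <= phi (F x').
Proof.
move=> phiC [d [Cd _] ->] xR x'R; have [_ phi0] := phiC.
have := dual_cone_taylor phiC xR x'R; rewrite addrAC subrr add0r.
by have := phi0 _ Cd; lra.
Qed.

Lemma newton_step_le x x' r : ball xt R x -> L * `|x - xt| < 1 -> 0 <= r ->
    (forall phi, dual_cone C phi -> - (N phi * r) <= phi (F x)) ->
  newton_step F C x x' -> `|x' - x| <= r / (1 - L * `|x - xt|).
Proof.
move=> xR xt1 r0 Hr [d [_ dmin] ->].
have [w wr Cw] := newton_direction_le xR xt1 r0 Hr.
by rewrite addrAC subrr add0r (le_trans (dmin _ Cw)).
Qed.

End RobinsonNewton.

(** * The majorant sequence *)

Section MajorantSequence.
Context {K : realType}.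
Variables (L b rho : K).
Hypotheses (L_gt0 : 0 < L) (b_gt0 : 0 < b) (rho_ge0 : 0 <= rho)
  (rho_lt : rho < (1 - 2 * L * b) / (4 * L)).

Local Notation g := (majorant L b rho).
Local Notation ts := (majorant_root L b rho).
Local Notation t := (newton_real g 0).
Local Notation sq := (Num.sqrt (1 - 2 * L * (b + 2 * rho))).

Let rhoL : 4 * (L * rho) + 2 * (L * b) < 1.
Proof.
have L4 : 0 < 4 * L by have := L_gt0; lra.
by move: rho_lt; rewrite ltr_pdivlMr//; lra.
Qed.

Lemma majorant_sqrt_gt0 : 0 < sq.
Proof. by rewrite sqrtr_gt0; have := rhoL; lra. Qed.

Lemma majorant_rho_lt1 : 0 < 1 - L * rho.
Proof.
have := rhoL; have := mulr_ge0 (ltW L_gt0) rho_ge0.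
by have := mulr_ge0 (ltW L_gt0) (ltW b_gt0); lra.
Qed.

Let L_neq0 : L != 0. Proof. by rewrite gt_eqF. Qed.
Let rho_neq1 : 1 - L * rho != 0.
Proof. by rewrite gt_eqF// majorant_rho_lt1. Qed.
Let rho_neq1' : L * rho - 1 != 0.
Proof. by rewrite -oppr_eq0 opprB. Qed.

(** With [b] expressed through [sq], the identities involving [b] become rational in a free
    variable, within reach of [field]. *)
Let bE : b = (1 - sq ^+ 2) / (2 * L) - 2 * rho.
Proof. by rewrite sqr_sqrtr; [field|have := rhoL; lra]. Qed.

(** Both sides are [- g'(s)] times [1 - L * rho]; the right one shows the sign for [s < ts]. *)
Lemma majorant_slopeE s : 1 - L * (s + rho) = sq + L * (ts - s).
Proof. by rewrite /majorant_root; field. Qed.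

(** Expansion at the root, in the variable [ts - s], where all coefficients are positive. *)
Lemma majorantE s :
  g s = (L / 2 * (ts - s) ^+ 2 + sq * (ts - s)) / (1 - L * rho).
Proof.
rewrite /majorant /majorant_root; move: bE; set r := sq => ->.
by field; rewrite L_neq0 rho_neq1 rho_neq1'.
Qed.

Lemma derive1_majorant s : derive1 g s = - (sq + L * (ts - s)) / (1 - L * rho).
Proof.
have dg : is_derive s 1 g (- 1 / (L * rho - 1) * (L * (s + rho) - 1)).
  rewrite /majorant; apply: is_derive_eq; rewrite /GRing.scale/=.
  by field.
rewrite derive1E (@derive_val _ _ _ _ _ _ _ dg) -majorant_slopeE.
by field; rewrite rho_neq1 rho_neq1'.
Qed.

Lemma majorant_root_gt0 : 0 < ts.
Proof.
rewrite /majorant_root divr_gt0// subr_gt0.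
have rL0 := mulr_ge0 (ltW L_gt0) rho_ge0.
have Lb0 := mulr_gt0 L_gt0 b_gt0.
rewrite -[ltRHS]ger0_norm -?sqrtr_sqr; last by have := rhoL; lra.
by rewrite ltr_sqrt; have := rhoL; nra.
Qed.

Lemma majorant_root_eq0 : g ts = 0.
Proof. by rewrite majorantE subrr expr0n /= !mulr0 addr0 mul0r. Qed.

Lemma majorant_gt0 s : s < ts -> 0 < g s.
Proof.
rewrite -subr_gt0 majorantE => u0; apply: divr_gt0; last exact: majorant_rho_lt1.
by rewrite addr_gt0// mulr_gt0 ?majorant_sqrt_gt0 ?exprn_gt0 ?divr_gt0.
Qed.

Let slope_gt0 s : s < ts -> 0 < sq + L * (ts - s).
Proof.
by rewrite -subr_gt0 => u0; rewrite addr_gt0 ?majorant_sqrt_gt0 ?mulr_gt0.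
Qed.

Lemma newton_majorant_step k : t k < ts ->
  t k.+1 = t k + (L / 2 * (ts - t k) ^+ 2 + sq * (ts - t k)) /
                 (sq + L * (ts - t k)).
Proof.
move=> /slope_gt0 sl; rewrite /= derive1_majorant majorantE.
by field; rewrite gt_eqF//= rho_neq1.
Qed.

(** Dropping [sq] from this denominator will give the factor 1/2, and dropping [L * (ts - t k)] the
    quadratic rate. *)
Lemma newton_majorant_error k : t k < ts ->
  ts - t k.+1 = (L / 2 * (ts - t k) ^+ 2) / (sq + L * (ts - t k)).
Proof.
move=> tk; rewrite newton_majorant_step//.
have := slope_gt0 tk; set u := ts - t k => sl.
have -> : ts = t k + u by rewrite /u; ring.
by field; rewrite gt_eqF.
Qed.

Lemma newton_majorant_lt k : t k < ts.
Proof.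
elim: k => [|k tk]; first exact: majorant_root_gt0.
rewrite -subr_gt0 newton_majorant_error// divr_gt0 ?slope_gt0//.
by rewrite mulr_gt0 ?divr_gt0// exprn_gt0// subr_gt0.
Qed.

Lemma newton_majorant_derive_neq0 k : derive1 g (t k) != 0.
Proof.
rewrite derive1_majorant mulf_neq0 ?invr_eq0 ?oppr_eq0 ?gt_eqF//.
  by rewrite slope_gt0// newton_majorant_lt.
exact: majorant_rho_lt1.
Qed.

Lemma newton_majorant_increasing k : t k < t k.+1.
Proof.
have tk := newton_majorant_lt k; have u0 : 0 < ts - t k by rewrite subr_gt0.
rewrite newton_majorant_step// ltrDl divr_gt0 ?slope_gt0//.
by rewrite addr_gt0// mulr_gt0 ?majorant_sqrt_gt0 ?divr_gt0// exprn_gt0.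
Qed.

Lemma newton_majorant_ge0 k : 0 <= t k.
Proof.
by elim: k => // k /le_trans; apply; rewrite ltW// newton_majorant_increasing.
Qed.

Lemma newton_majorant_half k : ts - t k.+1 <= 1 / 2 * (ts - t k).
Proof.
have tk := newton_majorant_lt k; have u0 : 0 < ts - t k by rewrite subr_gt0.
rewrite newton_majorant_error// ler_pdivrMr ?slope_gt0//.
by have := mulr_gt0 majorant_sqrt_gt0 u0; nra.
Qed.

Lemma newton_majorant_quadratic k :
  ts - t k.+1 <= quadratic_rate L b rho * (ts - t k) ^+ 2.
Proof.
have tk := newton_majorant_lt k; have u0 : 0 < ts - t k by rewrite subr_gt0.
have s0 := majorant_sqrt_gt0.
rewrite newton_majorant_error// /quadratic_rate mulrAC ler_wpM2r ?sqr_ge0//.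
have sl := slope_gt0 tk.
rewrite ler_pdivrMr// mulrAC ler_pdivlMr ?mulr_gt0//.
by have := mulr_gt0 (mulr_gt0 L_gt0 L_gt0) u0; lra.
Qed.

Lemma newton_majorant_cvg : t k @[k --> \oo] --> ts.
Proof.
have geo k : ts - t k <= ts * (1 / 2) ^+ k.
  elim: k => [|k IH]; first by rewrite subr0 expr0 mulr1.
  by apply: le_trans (newton_majorant_half k) _; rewrite exprS; lra.
suff : ts - t k @[k --> \oo] --> (0 : K).
  move=> h; have <- : (fun k => ts - (ts - t k)) = t.
    by apply/funext => k; ring.
  by rewrite -[X in _ --> X]subr0; apply: cvgB => //; exact: cvg_cst.
have squeeze : \forall k \near \oo, cst 0 k <= ts - t k <= ts * (1 / 2) ^+ k.
  by near=> k; rewrite geo andbT subr_ge0 ltW// newton_majorant_lt.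
apply: (squeeze_cvgr squeeze); first exact: cvg_cst.
by apply: cvg_geometric; rewrite ger0_norm; lra.
Unshelve. all: by end_near. Qed.

(** The linearization of [g] at [t k] vanishes at [t k.+1], so only the quadratic term of [g]
    remains there. *)
Lemma newton_majorant_diff k : t k.+2 - t k.+1 =
  L / 2 * (t k.+1 - t k) ^+ 2 / (1 - L * (t k.+1 + rho)).
Proof.
have tk := newton_majorant_lt k; have tk1 := newton_majorant_lt k.+1.
rewrite majorant_slopeE (newton_majorant_step tk1) addrC addrA addNr add0r.
have sl1 := slope_gt0 tk1; have sl := slope_gt0 tk.
congr (_ / _); rewrite newton_majorant_error//.
have -> : t k.+1 - t k = (ts - t k) - (ts - t k.+1) by ring.
rewrite newton_majorant_error//; move: sl; set u := ts - t k => sl.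
by field; rewrite gt_eqF.
Qed.

(** The numerator is the bound of [initial_residual]: in the majorant, [2 * rho] less the [rho] of
    the linear term leaves one [rho]. *)
Lemma newton_majorant_first :
  t 1%N = (b + rho + L / 2 * rho ^+ 2) / (1 - L * rho).
Proof.
rewrite newton_majorant_step ?majorant_root_gt0// -majorant_slopeE /= !add0r.
rewrite subr0; congr (_ / _); rewrite /majorant_root; move: bE.
by set r := sq => ->; field.
Qed.

End MajorantSequence.

(** * Sequences with controlled increments *)

Section SequenceLemmas.
Context {K : realType}.

Lemma limn_esup_le_near (u : nat -> K) (l : K) :
  (forall e, 0 < e -> \forall k \near \oo, u k <= l + e) ->
  (limn_esup (fun k => (u k)%:E) <= l%:E)%E.
Proof.
move=> ul; apply/lee_addgt0Pr => e e0; rewrite -EFinD.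
rewrite /limn_esup limf_esupE.
apply: (@le_trans _ _ (ereal_sup ((fun k => (u k)%:E) @` [set k | u k <= l + e]))).
  by apply: ereal_inf_lbound; exists [set k | u k <= l + e] => //; exact: ul.
by apply: ge_ereal_sup => _ [k uk <-]; rewrite lee_fin.
Qed.

Variables (X : normedModType K) (x : nat -> X).

(** Increments are controlled up to [n] only, so that finite runs of the method are covered. *)
Lemma sum_increments_le (s : nat -> K) (n m : nat) :
    (forall k, (k < n)%N -> `|x k.+1 - x k| <= s k.+1 - s k) ->
  forall k, (m + k <= n)%N -> `|x (m + k)%N - x m| <= s (m + k)%N - s m.
Proof.
move=> hx; elim=> [|k IH]; first by rewrite addn0 !subrr normr0.
rewrite addnS => mkn.
have := ler_normD (x (m + k).+1 - x (m + k)%N) (x (m + k)%N - x m).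
rewrite addrA subrK => /le_trans; apply.
by have := hx _ mkn; have := IH (ltnW mkn); lra.
Qed.

Lemma geometric_increments_le (xs : X) (k : nat) (th : K) : th < 1 ->
    (forall j, (k <= j)%N -> `|x j.+2 - x j.+1| <= th * `|x j.+1 - x j|) ->
    x n @[n --> \oo] --> xs ->
  `|xs - x k| <= `|x k.+1 - x k| / (1 - th).
Proof.
move=> th1 hx xxs; have th0 : 0 < 1 - th by rewrite subr_gt0.
(* Subtracting the current increment makes the induction telescope: [1 - th] times an increment is
   at most its excess over the next one. *)
have tele m : `|x (k + m)%N - x k| <=
    (`|x k.+1 - x k| - `|x (k + m).+1 - x (k + m)%N|) / (1 - th).
  elim: m => [|m IH]; first by rewrite addn0 !subrr normr0 mul0r.
  rewrite addnS.
  have := ler_normD (x (k + m).+1 - x (k + m)%N) (x (k + m)%N - x k).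
  rewrite addrA subrK => /le_trans; apply.
  have := hx (k + m)%N (leq_addr _ _); move: IH.
  rewrite !ler_pdivlMr//; lra.
have /cvgr_to_le : `|x n - x k| @[n --> \oo] --> `|xs - x k|.
  by apply: cvg_norm; apply: cvgB => //; exact: cvg_cst.
apply; near=> n; have kn : (k <= n)%N by near: n; exact: nbhs_infty_ge.
rewrite -(subnKC kn); apply: le_trans (tele _) _.
by rewrite ler_pM2r ?invr_gt0// lerBlDr lerDl.
Unshelve. all: by end_near. Qed.

(* With [th] a bound of [q * delta_k], where [delta_k] is the k-th increment,
   the tail at [k + 1] is at most [q * delta_k ^+ 2 / (1 - th)], and the tail at
   [k] is at least [delta_k * (1 - 2 * th) / (1 - th)]. *)
Lemma quadratic_increments_limn_esup (xs : X) (q : K) : 0 <= q ->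
    (forall k, `|x k.+2 - x k.+1| <= q * `|x k.+1 - x k| ^+ 2) ->
    x n @[n --> \oo] --> xs ->
  (limn_esup (fun k => (`|xs - x k.+1| / `|xs - x k| ^+ 2)%:E) <= q%:E)%E.
Proof.
move=> q0 hx xxs; apply: limn_esup_le_near => e e0.
(* The second bound gives [8 * th * q <= e], with [q + 1] keeping the denominator positive; the
   first is what [(1 + 8 * th) * (1 - 4 * th) >= 1] requires. *)
pose th := Num.min (1 / 8) (e / (8 * (q + 1))).
have q8 : 0 < 8 * (q + 1) by lra.
have th0 : 0 < th by rewrite lt_min divr_gt0//= divr_gt0.
have th8 : th <= 1 / 8 by rewrite ge_min lexx.
have the : 8 * th * q <= e.
  have : th <= e / (8 * (q + 1)) by rewrite ge_min lexx orbT.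
  by rewrite ler_pdivlMr//; lra.
have x1xs : x n.+1 @[n --> \oo] --> xs by rewrite cvg_shiftS.
have : q * `|x n.+1 - x n| @[n --> \oo] --> q * `|xs - xs|.
  by apply: cvgMr; apply: cvg_norm; exact: cvgB.
rewrite subrr normr0 mulr0 => /cvgr_lt/(_ _ th0)[n _ hn].
exists n => // k /= nk.
have small j : (k <= j)%N -> `|x j.+2 - x j.+1| <= th * `|x j.+1 - x j|.
  move=> kj; apply: le_trans (hx j) _; rewrite expr2 mulrA ler_wpM2r//.
  by apply: ltW; apply: hn => /=; exact: leq_trans kj.
have th1 : 0 < 1 - th by lra.
have tail : `|xs - x k.+1| <= `|x k.+2 - x k.+1| / (1 - th).
  apply: geometric_increments_le => //; first by lra.
  by move=> j kj; apply: small; exact: ltnW.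
(* If [x k = xs], the quotient is 0 by the convention on division by zero. *)
have [c0|c0] := eqVneq (`|xs - x k|) 0.
  by rewrite c0 expr0n /= invr0 mulr0; lra.
have cp : 0 < `|xs - x k| by rewrite lt_neqAle eq_sym c0 normr_ge0.
rewrite ler_pdivrMr ?exprn_gt0//.
have tri : `|x k.+1 - x k| <= `|xs - x k| + `|xs - x k.+1|.
  have -> : x k.+1 - x k = (xs - x k) - (xs - x k.+1).
    by rewrite opprB [RHS]addrC addrA subrK.
  exact: ler_normB.
move: tail (hx k) (small k (leqnn _)) tri the cp; rewrite ler_pdivlMr//.
set a := `|xs - x k.+1|; set c := `|xs - x k|; set d := `|x k.+1 - x k|.
set d' := `|x k.+2 - x k.+1| => ad' d'q d'th tri the cp.
have d0 : 0 <= d by exact: normr_ge0.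
have dc : d * (1 - 2 * th) <= c * (1 - th) by nra.
have dc2 : d ^+ 2 * (1 - 2 * th) ^+ 2 <= c ^+ 2 * (1 - th) ^+ 2.
  by rewrite -!exprMn lerXn2r// nnegrE; nra.
have th2 : 1 - 4 * th <= (1 - 2 * th) ^+ 2 by nra.
have d2 : d ^+ 2 <= (1 + 8 * th) * (1 - th) ^+ 2 * c ^+ 2.
  have h1 : 1 <= (1 + 8 * th) * (1 - 2 * th) ^+ 2 by nra.
  have := ler_wpM2l (sqr_ge0 d) h1; rewrite mulr1 => /le_trans; apply.
  have p : 0 <= 1 + 8 * th by lra.
  by have := ler_wpM2l p dc2; lra.
have a1 : a * (1 - th) <= q * (1 + 8 * th) * (1 - th) * c ^+ 2 * (1 - th).
  apply: le_trans ad' _; apply: le_trans d'q _.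
  by have := ler_wpM2l q0 d2; lra.
have a2 : a <= q * (1 + 8 * th) * (1 - th) * c ^+ 2 by rewrite -(ler_pM2r th1).
apply: le_trans a2 _; apply: ler_wpM2r; first exact: sqr_ge0.
have qq : 0 <= q * (1 + 8 * th) by apply: mulr_ge0 => //; lra.
by have := mulr_ge0 qq (ltW th0); lra.
Qed.

End SequenceLemmas.

(** * Majorization of the iterates *)

Section Majorization.
Context {K : realType} {X Y : normedModType K}.
Variables (F : X -> Y) (C : set Y) (xt : X) (R L b rho : K).
Hypotheses (X_reflexive : reflexive_space X)
  (F_diff : forall x, ball xt R x -> differentiable F x)
  (C_nonempty : C !=set0) (C_closed : closed C) (C_segment : segment_closed C)
  (C_cone : is_cone C) (R_gt0 : 0 < R) (L_gt0 : 0 < L) (b_gt0 : 0 < b)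
  (F_robinson : robinson_condition F C xt)
  (F_lipschitz : forall x y, ball xt R x -> ball xt R y ->
    (sv_norm (fun d => Tmap_inv F C xt ('d F y d - 'd F x d)%R)
       <= (L * `|y - x|)%:E)%E)
  (F_xt : (set_norm (Tmap_inv F C xt (- F xt)%R) <= b%:E)%E)
  (rho_ge0 : 0 <= rho) (rho_lt : rho < (1 - 2 * L * b) / (4 * L))
  (R_large : majorant_root L b rho + rho <= R).

Local Notation ts := (majorant_root L b rho).
Local Notation t := (newton_real (majorant L b rho) 0).
Local Notation N phi := (dual_norm (phi \o 'd F xt)).

Variable xh : X.
Hypothesis xh_rho : ball xt rho xh.

Let L_ge0 : 0 <= L := ltW L_gt0.

Let xh_lt : `|xh - xt| < rho.
Proof. by move: xh_rho; rewrite -ball_normE /= distrC. Qed.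

Let dist_xt y s : `|y - xh| <= s -> `|y - xt| < s + rho.
Proof.
move=> ys; have -> : y - xt = (y - xh) + (xh - xt) by rewrite addrA subrK.
by apply: le_lt_trans (ler_normD _ _) _; rewrite ler_ltD.
Qed.

(** Here [R_large] keeps all points within [ts] of [xh] in the region of the Lipschitz
    hypothesis. *)
Lemma majorized_ball y : `|y - xh| <= ts -> ball xt R y.
Proof.
move=> /dist_xt yts; rewrite -ball_normE /= distrC.
exact: lt_le_trans R_large.
Qed.

(** The shift by [rho] in the majorant pays for measuring distances from [xh] instead of [xt]. *)
Lemma majorized_slope y s : `|y - xh| <= s -> s <= ts ->
  0 < 1 - L * (s + rho) /\ 1 - L * (s + rho) <= 1 - L * `|y - xt|.
Proof.
move=> ys sts; split; last first.
  by rewrite lerD2l lerN2 ler_wpM2l// ltW// dist_xt.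
rewrite (majorant_slopeE b)//; have sq0 := majorant_sqrt_gt0 L_gt0 rho_lt.
have : 0 <= L * (ts - s) by rewrite mulr_ge0// subr_ge0.
by move: sq0; set r := Num.sqrt _; lra.
Qed.

Let slope_lt1 y s : `|y - xh| <= s -> s <= ts -> L * `|y - xt| < 1.
Proof.
by move=> ys sts; have [] := majorized_slope ys sts; lra.
Qed.

(** Taylor's bound from [xt] to [xh]: [b] controls the value at [xt], [rho] the linear term,
    [L / 2 * rho ^+ 2] the remainder. *)
Lemma initial_residual phi : dual_cone C phi ->
  - (N phi * (b + rho + L / 2 * rho ^+ 2)) <= phi (F xh).
Proof.
move=> phiC; have [dphi _] := phiC; have xtR := ballxx xt R_gt0.
have N0 : 0 <= N phi by exact: (dual_cone_N_ge0 F_diff R_gt0 phiC).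
have ts0 : 0 <= ts by exact: ltW (majorant_root_gt0 L_gt0 b_gt0 rho_ge0 rho_lt).
have xhR : ball xt R (xt + (xh - xt)).
  by rewrite addrC subrK; apply: majorized_ball; rewrite subrr normr0.
have := dual_cone_taylor F_diff R_gt0 F_robinson F_lipschitz phiC xtR xhR.
rewrite [xt + (xh - xt)]addrC subrK; apply: le_trans.
have := dual_cone_Tmap_inv F_diff R_gt0 phiC F_xt; rewrite dualN// => Fxt.
have dA := dual_cone_diff F_diff phiC xtR.
have := dual_normP (- (xh - xt)) dA; rewrite normrN dualN//= => Axh.
rewrite dualD//.
set e := `|xh - xt| in Axh *.
have e_rho : e <= rho by exact: ltW.
have e0 : 0 <= e by exact: normr_ge0.
have e2 : L / 2 * e ^+ 2 <= L / 2 * rho ^+ 2.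
  by apply: ler_wpM2l; [exact: divr_ge0|rewrite lerXn2r].
by have := ler_wpM2l N0 e_rho; have := ler_wpM2l N0 e2; lra.
Qed.

Lemma quadratic_step x x' x'' s : newton_step F C x x' ->
    newton_step F C x' x'' -> `|x - xh| <= ts -> `|x' - xh| <= s -> s <= ts ->
  `|x'' - x'| <= L / 2 * `|x' - x| ^+ 2 / (1 - L * (s + rho)).
Proof.
move=> st st' xxh x'xh sts; have [sl0 sl] := majorized_slope x'xh sts.
have xR := majorized_ball xxh.
have x'R := majorized_ball (le_trans x'xh sts).
have r0 : 0 <= L / 2 * `|x' - x| ^+ 2 by rewrite mulr_ge0 ?divr_ge0 ?sqr_ge0.
have := newton_step_le X_reflexive F_diff C_nonempty C_closed C_segment C_cone
  R_gt0 L_ge0 F_robinson F_lipschitz x'R (slope_lt1 x'xh sts) r0 _ st'.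
move=> /(_ (fun phi phiC => newton_residual F_diff R_gt0 F_robinson F_lipschitz
  phiC st xR x'R)) /le_trans; apply.
by rewrite ler_wpM2l// lef_pV2// posrE (lt_le_trans sl0).
Qed.

Lemma first_step x' : newton_step F C xh x' -> `|x' - xh| <= t 1%N.
Proof.
move=> st; have ts0 := majorant_root_gt0 L_gt0 b_gt0 rho_ge0 rho_lt.
have xh0 : `|xh - xh| <= 0 by rewrite subrr normr0.
have [sl0 sl] := majorized_slope xh0 (ltW ts0).
have xhR := majorized_ball (le_trans xh0 (ltW ts0)).
have r0 : 0 <= b + rho + L / 2 * rho ^+ 2.
  by have := mulr_ge0 (ltW L_gt0) (sqr_ge0 rho); have := b_gt0;
     have := rho_ge0; lra.
have := newton_step_le X_reflexive F_diff C_nonempty C_closed C_segment C_cone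
  R_gt0 L_ge0 F_robinson F_lipschitz xhR (slope_lt1 xh0 (ltW ts0)) r0
  initial_residual st.
move=> /le_trans; apply; rewrite newton_majorant_first//.
by move: sl0 sl; rewrite add0r => sl0 sl; rewrite ler_wpM2l// lef_pV2// posrE
  (lt_le_trans sl0).
Qed.

(** Induction on the length of the run: the bounds on earlier increments keep the points within
    [t j] of [xh], where [quadratic_step] applies and is dominated by [newton_majorant_diff]. *)
Lemma majorized_increments (n : nat) (x : nat -> X) : x 0%N = xh ->
    (forall k, (k < n)%N -> newton_step F C (x k) (x k.+1)) ->
  forall k, (k < n)%N -> `|x k.+1 - x k| <= t k.+1 - t k.
Proof.
move=> x0; elim: n => // n IH st k.
have {}IH := IH (fun j jn => st j (ltnW jn)).
rewrite ltnS leq_eqVlt => /predU1P[->|/IH//].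
have dist j : (j <= n)%N -> `|x j - xh| <= t j.
  move=> jn; have := @sum_increments_le _ _ _ _ _ 0 IH j jn.
  by rewrite x0 subr0.
case: n st IH dist => [st _ _|n st IH dist].
  by rewrite x0 [t 0%N]/= subr0; apply: first_step; rewrite -x0; exact: st.
have tts j : t j <= ts by rewrite ltW// newton_majorant_lt.
have := quadratic_step (st n (ltnW (ltnSn _))) (st n.+1 (ltnSn _))
  (le_trans (dist n (leqnSn n)) (tts n)) (dist _ (leqnn _)) (tts _).
move=> /le_trans; apply; rewrite newton_majorant_diff//.
have [sl0 _] := majorized_slope (dist _ (leqnn _)) (tts n.+1).
apply: ler_wpM2r; first by rewrite invr_ge0 ltW.
apply: ler_wpM2l; first by rewrite divr_ge0.
rewrite lerXn2r ?nnegrE//; last exact: IH.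
by rewrite subr_ge0 ltW// newton_majorant_increasing.
Qed.

Lemma majorized_dist (n : nat) (x : nat -> X) : x 0%N = xh ->
    (forall k, (k < n)%N -> newton_step F C (x k) (x k.+1)) ->
  `|x n - xh| <= t n.
Proof.
move=> x0 st.
have := @sum_increments_le _ _ _ _ _ 0 (majorized_increments x0 st) n (leqnn n).
by rewrite x0 subr0.
Qed.

(** With [r = 0], [linear_system_solvable] acts as the bipolar theorem: it suffices that
    [phi (F xs) >= 0] on the dual cone. This is the limit of [newton_residual], whose bounds vanish
    with the increments. *)
Lemma limit_feasible (x : nat -> X) (xs : X) : ball xt R xs ->
    (forall k, ball xt R (x k)) ->
    (forall k, newton_step F C (x k) (x k.+1)) -> x n @[n --> \oo] --> xs ->
  C (F xs).
Proof.
move=> xsR xR st xxs.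
have x1xs : x n.+1 @[n --> \oo] --> xs by rewrite cvg_shiftS.
have cF : {for xs, continuous F} by exact/differentiable_continuous/F_diff.
have [|phi phiC|w] := @linear_system_solvable _ _ _ ('d F xs) C X_reflexive _
    C_closed C_segment (F xs) 0 C_nonempty C_cone (lexx 0).
- exact/diff_continuous/F_diff.
- rewrite mulr0 oppr0; have [dphi _] := phiC.
  have lim_d : L / 2 * `|x n.+1 - x n| ^+ 2 @[n --> \oo] -->
      L / 2 * `|xs - xs| ^+ 2.
    apply: cvgMr.
    have lim_n : `|x n.+1 - x n| @[n --> \oo] --> `|xs - xs|.
      by apply: cvg_norm; exact: cvgB.
    under eq_fun do rewrite expr2.
    by rewrite expr2; exact: cvgM.
  have lim_F : phi (F (x n.+1)) @[n --> \oo] --> phi (F xs).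
    apply: (cvg_comp (fun n => F (x n.+1)) phi); last exact: dphi.2.
    by apply: (cvg_comp (fun n => x n.+1) F x1xs).
  have lim_sum : N phi * (L / 2 * `|x n.+1 - x n| ^+ 2) + phi (F (x n.+1))
      @[n --> \oo] --> N phi * (L / 2 * `|xs - xs| ^+ 2) + phi (F xs).
    by apply: cvgD => //; exact: cvgMr.
  have := cvgr_to_ge lim_sum.
  rewrite subrr normr0 expr0n /= !mulr0 add0r; apply.
  near=> n; rewrite -lerBlDl sub0r.
  exact: (newton_residual F_diff R_gt0 F_robinson F_lipschitz phiC (st n)).
rewrite normr_le0 => /eqP ->.
by rewrite linear0 addr0.
Unshelve. all: by end_near. Qed.

End Majorization.

(** * Convergence of the Newton iterates and error bounds *)

Theorem theorem19 (K : realType) (X Y : completeNormedModType K)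
    (X_reflexive : reflexive_space X)
    (Omega : set X) (Omega_open : open Omega)
    (F : X -> Y) (F_C1 : continuously_differentiable_on Omega F)
    (C : set Y) (C_nonempty : C !=set0) (C_closed : closed C)
    (C_convex : convex_set C) (C_cone : is_cone C)
    (xt : X) (xt_Omega : Omega xt)
    (R L b : K) (R_gt0 : 0 < R) (L_gt0 : 0 < L) (b_gt0 : 0 < b)
    (F_robinson : robinson_condition F C xt)
    (ball_Omega : ball xt R `<=` Omega)
    (F_lipschitz : forall x y, ball xt R x -> ball xt R y ->
      (sv_norm (fun d => Tmap_inv F C xt ('d F y d - 'd F x d)%R)
         <= (L * `|y - x|)%:E)%E)
    (bL_lt1 : 2 * b * L < 1)
    (F_xt : (set_norm (Tmap_inv F C xt (- F xt)%R) <= b%:E)%E)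
    (rho : K) (rho_ge0 : 0 <= rho) (rho_lt : rho < (1 - 2 * L * b) / (4 * L))
    (R_large : majorant_root L b rho + rho <= R) :
  let g := majorant L b rho in
  let ts := majorant_root L b rho in
  let t := newton_real g 0 in
  let q := quadratic_rate L b rho in
  [/\ 0 <= ts, g ts = 0 & forall s, 0 <= s -> g s = 0 -> ts <= s] /\
  [/\ forall k, derive1 g (t k) != 0,
      forall k, t k < t k.+1,
      forall k, 0 <= t k < ts,
      t k @[k --> \oo] --> ts &
      forall k, ts - t k.+1 <= 1 / 2 * (ts - t k) /\
                ts - t k.+1 <= q * (ts - t k) ^+ 2] /\
  forall xh : X, ball xt rho xh ->
    newton_well_defined F C Omega xh /\
    forall x : nat -> X, x 0%N = xh ->
      (forall k, newton_step F C (x k) (x k.+1)) ->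
      [/\ forall k, ball xh ts (x k),
          forall k, `|x k.+1 - x k| <= t k.+1 - t k &
          forall k,
            `|x k.+2 - x k.+1|
              <= (t k.+2 - t k.+1) / (t k.+1 - t k) ^+ 2
                 * `|x k.+1 - x k| ^+ 2 /\
            (t k.+2 - t k.+1) / (t k.+1 - t k) ^+ 2 * `|x k.+1 - x k| ^+ 2
              <= q * `|x k.+1 - x k| ^+ 2] /\
      exists xs : X,
        [/\ x k @[k --> \oo] --> xs,
            closed_ball_ Num.norm xh ts xs,
            Omega xs /\ C (F xs),
            forall k, `|xs - x k| <= ts - t k &
            (limn_esup (fun k =>
               (`|xs - x k.+1| / `|xs - x k| ^+ 2)%:E) <= q%:E)%E].
Proof.
have F_diff x : ball xt R x -> differentiable F x.
  by move=> xR; apply: F_C1.1; exact: ball_Omega.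
have C_segment := convex_set_segment_closed C_convex.
move=> g ts t q.
have ts0 : 0 < ts by exact: majorant_root_gt0.
have tlt k : t k < ts by exact: newton_majorant_lt.
have t_ge0 k : 0 <= t k by exact: newton_majorant_ge0.
have tincr k : t k < t k.+1 by exact: newton_majorant_increasing.
split.
  split; [exact: ltW|exact: majorant_root_eq0|].
  move=> s _ gs0; rewrite leNgt; apply/negP => sts.
  by have := majorant_gt0 L_gt0 b_gt0 rho_ge0 rho_lt sts;
     rewrite [majorant _ _ _ _]gs0 ltxx.
split.
  split => //.
  - by move=> k; exact: newton_majorant_derive_neq0.
  - by move=> k; rewrite t_ge0 tlt.
  - exact: newton_majorant_cvg.
  - move=> k; split; first exact: newton_majorant_half.
    exact: newton_majorant_quadratic.
move=> xh xh_rho.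
(* Stated for finite runs, over which [newton_well_defined] quantifies. *)
have dist n (x : nat -> X) : x 0%N = xh ->
    (forall k, (k < n)%N -> newton_step F C (x k) (x k.+1)) ->
  `|x n - xh| <= t n.
  exact: (majorized_dist X_reflexive F_diff C_nonempty C_closed C_segment
    C_cone R_gt0 L_gt0 b_gt0 F_robinson F_lipschitz F_xt rho_ge0 rho_lt R_large
    xh_rho).
have in_ball y : `|y - xh| <= ts -> ball xt R y.
  exact: (majorized_ball R_large xh_rho).
split.
  move=> n x x0 st; have xn := dist _ _ x0 st.
  have xnR := in_ball _ (le_trans xn (ltW (tlt n))).
  split; first exact: ball_Omega.
  have [sl0 sl] := majorized_slope L_gt0 rho_lt xh_rho xn (ltW (tlt n)).
  apply: (newton_directions_nonempty X_reflexive F_diff C_nonempty C_closed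
    C_segment C_cone R_gt0 (ltW L_gt0) F_robinson F_lipschitz xnR).
  by lra.
move=> x x0 st.
have xdist k : `|x k - xh| <= t k by apply: dist.
have incr k : `|x k.+1 - x k| <= t k.+1 - t k.
  exact: (majorized_increments X_reflexive F_diff C_nonempty C_closed C_segment
    C_cone R_gt0 L_gt0 b_gt0 F_robinson F_lipschitz F_xt rho_ge0 rho_lt R_large
    xh_rho
    x0 (fun j (_ : (j < k.+1)%N) => st j) (ltnSn k)).
have dt k : 0 < t k.+1 - t k by rewrite subr_gt0.
have sq0 : 0 < Num.sqrt (1 - 2 * L * (b + 2 * rho)) by exact: majorant_sqrt_gt0.
have slope k : 0 < 1 - L * (t k + rho).
  by have [] := majorized_slope L_gt0 rho_lt xh_rho (xdist k) (ltW (tlt k)).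
(* In this form the coefficient is bounded by [q], because the slope factor is at least the square
   root. *)
have coefE k : (t k.+2 - t k.+1) / (t k.+1 - t k) ^+ 2 =
    L / 2 / (1 - L * (t k.+1 + rho)).
  rewrite newton_majorant_diff//; have := slope k.+1; have := dt k.
  by rewrite -/g -/t => d0 s0; field; rewrite !gt_eqF.
have quad k : `|x k.+2 - x k.+1|
    <= (t k.+2 - t k.+1) / (t k.+1 - t k) ^+ 2 * `|x k.+1 - x k| ^+ 2.
  rewrite coefE mulrAC.
  exact: (quadratic_step X_reflexive F_diff C_nonempty C_closed C_segment C_cone
    R_gt0 L_gt0 F_robinson F_lipschitz rho_lt R_large xh_rho (st k) (st k.+1)
    (le_trans (xdist k) (ltW (tlt k))) (xdist k.+1) (ltW (tlt k.+1))).
have rate k : (t k.+2 - t k.+1) / (t k.+1 - t k) ^+ 2 * `|x k.+1 - x k| ^+ 2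
    <= q * `|x k.+1 - x k| ^+ 2.
  rewrite ler_wpM2r ?sqr_ge0// coefE /q /quadratic_rate invfM mulrA.
  apply: ler_wpM2l; first by rewrite divr_ge0// ltW.
  rewrite lef_pV2 ?posrE//.
  rewrite [leRHS](majorant_slopeE b)// lerDl; apply: mulr_ge0; first exact: ltW.
  by rewrite subr_ge0 ltW.
split.
  split => // k; rewrite -ball_normE /= distrC.
  exact: le_lt_trans (xdist k) (tlt k).
have xmn k n : (k <= n)%N -> `|x n - x k| <= t n - t k.
  move=> kn; rewrite -(subnKC kn).
  by apply: (@sum_increments_le _ _ _ _ n) => [j _|]; [exact: incr|rewrite subnKC].
have t_cvg : t k @[k --> \oo] --> ts by exact: newton_majorant_cvg.
have x_cvg : cvg (x n @[n --> \oo]).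
  (* The tail after [n] stays within [ts - t n] of [x n], so convergence of [t] makes [x] Cauchy. *)
  apply/cauchy_cvgP/cauchy_exP => e e0.
  have [n _ hn] : \forall n \near \oo, ts - e < t n.
    by apply: (cvgr_gt _ t_cvg); lra.
  exists (x n); exists n => // m /= nm; rewrite -ball_normE /= distrC.
  apply: le_lt_trans (xmn _ _ nm) _.
  by have := hn n (leqnn n); have := tlt m; rewrite /=; lra.
pose xs := lim (x n @[n --> \oo]).
have xxs : x n @[n --> \oo] --> xs by exact: x_cvg.
have xs_le k : `|xs - x k| <= ts - t k.
  have lim_d : `|x n - x k| @[n --> \oo] --> `|xs - x k|.
    by apply: cvg_norm; apply: cvgB => //; exact: cvg_cst.
  apply: (cvgr_to_le lim_d); near=> n.
  have kn : (k <= n)%N by near: n; exact: nbhs_infty_ge.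
  by apply: le_trans (xmn _ _ kn) _; rewrite lerD2r ltW.
have xs_xh : `|xs - xh| <= ts by have := xs_le 0%N; rewrite x0 subr0.
have xsR : ball xt R xs by exact: in_ball.
exists xs; split => //.
- by rewrite /closed_ball_ /= distrC.
- split; first exact: ball_Omega.
  apply: (limit_feasible X_reflexive F_diff C_nonempty C_closed C_segment C_cone
    R_gt0 F_robinson F_lipschitz xsR _ st xxs) => k.
  by apply: in_ball; exact: le_trans (xdist k) (ltW (tlt k)).
- apply: quadratic_increments_limn_esup => //.
    by rewrite /q /quadratic_rate divr_ge0 ?mulr_ge0 ?ltW.
  by move=> k; exact: le_trans (quad k) (rate k).
Unshelve. all: by end_near. Qed.
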